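(* The $ij$-weakly Lindelöf property is not hereditary, and the pairwise weakly Lindelöf property is not hereditary. That is: for $i,j\in\{1,2\}$ with $i\neq j$, there exist an $ij$-weakly Lindelöf bitopological space $X$ and a subspace of $X$ which is not $ij$-weakly Lindelöf; and there exist a pairwise weakly Lindelöf bitopological space $X$ and a subspace of $X$ which is not pairwise weakly Lindelöf.
   Context: A bitopological space $(X,\tau_1,\tau_2)$ is a set $X$ with two topologies $\tau_1,\tau_2$. For $i\in\{1,2\}$, ''$i$-open'' means open with respect to $\tau_i$, and $i\text{-}\mathrm{cl}$ denotes closure with respect to $\tau_i$. Countable means at most countable. For $i\neq j$ in $\{1,2\}$, $X$ is $ij$-weakly Lindelöf if for every cover $\{U_\alpha:\alpha\in\Delta\}$ of $X$ by $i$-open sets there is a countable subset $\{\alpha_n:n\in\mathbb{N}\}$ of $\Delta$ such that $X=j\text{-}\mathrm{cl}\left(\bigcup_{n\in\mathbb{N}}U_{\alpha_n}\right)$. $X$ is pairwise weakly Lindelöf if it is both $12$-weakly Lindelöf and $21$-weakly Lindelöf. A subspace of $X$ is a subset $S\subseteq X$ equipped with the two subspace topologies induced by $\tau_1$ and $\tau_2$. *)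

(* Defs.v *)
From HB Require Import structures.
From mathcomp Require Import all_boot all_order all_algebra.
From mathcomp Require Import all_classical topology.

Set Implicit Arguments.
Unset Strict Implicit.
Unset Printing Implicit Defensive.

Local Open Scope classical_set_scope.

(* The indices 1, 2 of the two topologies are represented by the elements
   0, 1 of 'I_2. *)
Record bitopologicalSpace := Bitopological {
  bicarrier :> Type;
  bitopology : 'I_2 -> Topological bicarrier }.

Definition bitop (X : bitopologicalSpace) (i : 'I_2) : topologicalType :=
  Topological.Pack (bitopology X i).

Definition iopen (X : bitopologicalSpace) (i : 'I_2) (A : set X) : Prop :=
  @open (bitop X i) A.

Definition iclosure (X : bitopologicalSpace) (i : 'I_2) (A : set X) : set X :=
  @closure (bitop X i) A.

Definition weaklyLindelof (i j : 'I_2) (X : bitopologicalSpace) : Prop :=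
  forall (I : Type) (Delta : set I) (U : I -> set X),
    (forall a, Delta a -> iopen i (U a)) ->
    \bigcup_(a in Delta) U a = [set: X] ->
    exists D : set I, [/\ D `<=` Delta, countable D &
      iclosure j (\bigcup_(a in D) U a) = [set: X]].

Definition pairwiseWeaklyLindelof (X : bitopologicalSpace) : Prop :=
  weaklyLindelof ord0 ord_max X /\ weaklyLindelof ord_max ord0 X.

(* set_type S is the subtype of the elements of S; the library equips it with
   the initial topology of its inclusion map. *)
Definition bisubspace (X : bitopologicalSpace) (S : set X)
    : bitopologicalSpace :=
  @Bitopological (set_type S)
    (fun i => Topological.class (@set_type (bitop X i) S : topologicalType)).

(* Main.v *)
(** Adjoin to an uncountable set T a point that belongs to every nonempty open
    set, and use this topology for both indices. Then every nonempty open set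
    is dense, so a single member of a cover suffices; but T itself is an
    uncountable discrete subspace. *)

Require Import Defs.
From HB Require Import structures.
From mathcomp Require Import all_boot all_order all_algebra.
From mathcomp Require Import all_classical topology.

Set Implicit Arguments.
Unset Strict Implicit.
Unset Printing Implicit Defensive.

Local Open Scope classical_set_scope.

(** Cantor's diagonal argument: for an injection [f] into [nat], the set [C] of those [n] that lie
    in no [A] with [f A = n] contains [f C] exactly when it does not. *)
Lemma uncountable_set_nat : ~ countable [set: set nat].
Proof.
move=> /countable_injP[f finj].
pose C := [set n | forall A, f A = n -> ~ A n].
have nC : ~ C (f C) by move=> CfC; exact: (CfC C).
apply: (nC) => A fA AfC; apply: nC.
by rewrite -{1}(finj A C (in_setT A) (in_setT C) fA).
Qed.

(** The adjoined point is [None]. The alias keeps the topology declared below apart from any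
    structure already attached to [option T]. *)
Definition particular_point (T : Type) : Type := option T.

Section ParticularPoint.
Variable T : choiceType.

HB.instance Definition _ := Choice.on (particular_point T).

Let op (A : set (particular_point T)) := A !=set0 -> A None.

Let opT : op setT. Proof. by []. Qed.

Let opI : setI_closed op.
Proof.
by move=> A B opA opB [x [Ax Bx]]; split; [apply: opA|apply: opB]; exists x.
Qed.

Let op_bigU (I : Type) (f : I -> set (particular_point T)) :
  (forall i, op (f i)) -> op (\bigcup_i f i).
Proof. by move=> opf [x [i _ fix_]]; exists i => //; apply: opf; exists x. Qed.

HB.instance Definition _ :=
  isOpenTopological.Build (particular_point T) opT opI op_bigU.

(** Any neighbourhood of any point contains a nonempty open set, hence [None], and so meets [A]. *)
Lemma particular_point_closure (A : set (particular_point T)) :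
  A None -> closure A = setT.
Proof.
move=> AN; apply/seteqP; split=> // x _ B.
rewrite nbhsE => -[V [oV Vx] VB]; exists None; split=> //.
by apply: VB; apply: oV; exists x.
Qed.

Definition particular_point_bitop : bitopologicalSpace :=
  Bitopological (fun _ : 'I_2 => Topological.class (particular_point T)).

Definition ordinary_points : set particular_point_bitop := ~` [set None].

Lemma weaklyLindelof_particular_point (i j : 'I_2) :
  weaklyLindelof i j particular_point_bitop.
Proof.
move=> I Delta U Uo Ucov.
have [a Da Ua] : (\bigcup_(a in Delta) U a) None by rewrite Ucov.
exists [set a]; split; [by move=> _ -> | exact: countable1 |].
by apply: particular_point_closure; exists a.
Qed.

Lemma open_ordinary_points (i : 'I_2) (A : set (bisubspace ordinary_points)) :
  iopen i A.
Proof.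
(* Adding [None] makes the image of [A] open and leaves its trace on the subspace unchanged. *)
exists (None |` [set set_val x | x in A]); first by left.
apply/seteqP; split=> [x [xN|[y Ay /val_inj <-]]//|x Ax]; last first.
  by right; exists x.
by case: (set_valP x xN).
Qed.

(** In the cover by singletons, indexed by the points themselves, the union over [D] is [D]. By
    discreteness [D] is closed, so it can be dense only if it is the whole subspace, which would
    then be countable. *)
Lemma not_weaklyLindelof_ordinary_points (i j : 'I_2) :
  ~ countable [set: T] -> ~ weaklyLindelof i j (bisubspace ordinary_points).
Proof.
move=> Tunc /(_ _ setT (fun x => [set x])) [].
- by move=> x _; exact: open_ordinary_points.
- by rewrite bigcup_imset1 image_id.
move=> D [_ Dcount]; rewrite bigcup_imset1 image_id.
have /closure_id : @closed (bitop (bisubspace ordinary_points) j) D.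
  by rewrite -openC; exact: open_ordinary_points.
rewrite /iclosure => <- DT; apply: Tunc.
have notN (t : T) : (Some t : particular_point_bitop) \in ordinary_points.
  by rewrite inE.
move: Dcount; rewrite DT => /countable_injP[f finj].
(* Countability passes to [T] along the injection [Some], which lands in the subspace by [notN]. *)
apply/countable_injP; exists (fun t => f (SigSub (notN t))) => s t _ _ fst.
by have [] := finj _ _ (in_setT _) (in_setT _) fst.
Qed.

End ParticularPoint.

Theorem mainTheorem1 :
  (forall i j : 'I_2, i != j ->
     exists (X : bitopologicalSpace) (S : set X),
       weaklyLindelof i j X /\ ~ weaklyLindelof i j (bisubspace S)) /\
  (exists (X : bitopologicalSpace) (S : set X),
     pairwiseWeaklyLindelof X /\ ~ pairwiseWeaklyLindelof (bisubspace S)).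
Proof.
have L := @weaklyLindelof_particular_point (set nat).
have nL i j :=
  @not_weaklyLindelof_ordinary_points (set nat) i j uncountable_set_nat.
split=> [i j _|]; exists (particular_point_bitop (set nat));
  exists (@ordinary_points (set nat)); split.
- exact: L.
- exact: nL.
- by split; exact: L.
- by case=> /nL.
Qed.
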